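(* Let $E$ and $F$ be real Hilbert spaces of dimension at least one, and let $c'>0$. Suppose that $A\subset E$ is an unbounded set with $\mu(A)\ge 1/c'>0$. Let $\varepsilon\ge0$ and let $f\colon A\to F$ be an $\varepsilon$-nearisometry. Then there is an isometry $T\colon E\to F$ onto a closed linear subspace $TE$ of $F$ such that \[ \sup\{|T(x)-P(f(x))|:x\in A\}\le J(F)\,c'\varepsilon\le\sqrt2\,c'\varepsilon, \] where $P\colon F\to TE$ is the orthogonal projection and $J(F)$ is the Jung constant of $F$.
   Context: For $\varepsilon\ge0$, a map $f\colon A\to F$ is an $\varepsilon$-nearisometry if $|x-y|-\varepsilon\le|f(x)-f(y)|\le|x-y|+\varepsilon$ for all $x,y\in A$. An isometry is a distance-preserving map (not assumed surjective or linear). The Jung constant $J(V)$ of a normed space $V$ is the infimum of all $r>0$ such that every set $Q\subset V$ with diameter at most $2$ is contained in a ball of radius $r$. For an unbounded set $A\subset E$, a unit vector $u\in E$ is a cluster direction of $A$ if there is a sequence $(x_j)$ in $A$ with $|x_j|\to\infty$ and $x_j/|x_j|\to u$. The set of all cluster directions of $A$ is denoted $\mathrm{cd}\,A$. For a subset $X$ of the unit sphere of $E$ and a unit vector $e\in E$, set $\sigma(e,X)=\sup\{|u\cdot e|:u\in X\}$ and $\mu_1(X)=\inf\{\sigma(e,X):e\in E,\ |e|=1\}$, with $\mu_1(\emptyset)=0$. For an unbounded set $A\subset E$ set $\mu(A)=\mu_1(\mathrm{cd}\,A)$. *)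

(* Defs.v *)
From HB Require Import structures.
From mathcomp Require Import all_boot all_order all_algebra.
From mathcomp Require Import all_classical all_reals all_analysis.

Set Implicit Arguments.
Unset Strict Implicit.
Unset Printing Implicit Defensive.

Import Order.TTheory GRing.Theory Num.Theory.
Import numFieldNormedType.Exports.

Local Open Scope classical_set_scope.
Local Open Scope ring_scope.

(* A real Hilbert space is a complete normed space [V] with a positive definite
   symmetric bilinear form [dot : {dot V for @idfun R}] inducing its norm. *)
Definition induces_norm (R : realType) (V : normedModType R)
    (dot : {dot V for @idfun R}) : Prop :=
  forall x : V, dot x x = `|x| ^+ 2.

(* The domain of a nearisometry is the set [A]: [f] is a total function whose
   values outside [A] play no role. *)
Definition nearisometry (R : realType) (E F : normedModType R)
    (eps : R) (A : set E) (f : E -> F) : Prop :=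
  forall x y : E, A x -> A y ->
    `|x - y| - eps <= `|f x - f y| <= `|x - y| + eps.

Definition distance_preserving (R : realType) (E F : normedModType R)
    (T : E -> F) : Prop :=
  forall x y : E, `|T x - T y| = `|x - y|.

(* Extended-real valued, so that an unbounded set has diameter +oo. *)
Definition diam (R : realType) (V : normedModType R) (Q : set V) : \bar R :=
  ereal_sup [set d | exists x y : V, [/\ Q x, Q y & d = `|x - y|%:E]].

(* The set of admissible radii contains 2 and is bounded below by 0, so the
   real-valued [inf] is a genuine infimum. *)
Definition jung (R : realType) (V : normedModType R) : R :=
  inf [set r : R | 0 < r /\
    forall Q : set V, (diam Q <= 2%:E)%E ->
      exists c : V, Q `<=` closed_ball c r].

Definition cluster_directions (R : realType) (E : normedModType R)
    (A : set E) : set E :=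
  [set u | `|u| = 1 /\
    exists x : nat -> E, [/\ forall j, A (x j),
      (fun j => `|x j|) @ \oo --> +oo &
      (fun j => `|x j|^-1 *: x j) @ \oo --> u]].

(* For a set [X] of unit vectors the values [`|dot u e|] are bounded by 1, so
   [sup] is a genuine supremum, except that [sup set0 = 0]: this gives
   [mu1 dot set0 = 0].  The infimum is over a nonempty set as soon as [E] is
   nonzero. *)
Definition sigma_dir (R : realType) (E : normedModType R)
    (dot : {dot E for @idfun R}) (e : E) (X : set E) : R :=
  sup [set `|dot u e| | u in X].

Definition mu1 (R : realType) (E : normedModType R)
    (dot : {dot E for @idfun R}) (X : set E) : R :=
  inf [set sigma_dir dot e X | e in [set e : E | `|e| = 1]].

Definition mu (R : realType) (E : normedModType R)
    (dot : {dot E for @idfun R}) (A : set E) : R :=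
  mu1 dot (cluster_directions A).

Definition closed_subspace (R : realType) (V : normedModType R)
    (M : set V) : Prop :=
  submod_closed (mem M) /\ closed M.

Definition orthogonal_projection (R : realType) (V : normedModType R)
    (dot : {dot V for @idfun R}) (M : set V) (P : V -> V) : Prop :=
  forall y : V, M (P y) /\ forall z : V, M z -> dot (y - P y) z = 0.

(* Main.v *)
Require Import Defs.
From HB Require Import structures.
From mathcomp Require Import all_boot all_order all_algebra.
From mathcomp Require Import all_classical all_reals all_analysis.
From mathcomp Require Import ring lra.

Set Implicit Arguments.
Unset Strict Implicit.
Unset Printing Implicit Defensive.

Import Order.TTheory GRing.Theory Num.Theory.
Import numFieldNormedType.Exports.

Local Open Scope classical_set_scope.
Local Open Scope ring_scope.

(** Far away along a cluster direction [u] of [A], the map [f] multiplies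
distances by a factor tending to 1, so that the rescaled values [f x_j / |x_j|]
converge to some [w] of [F], and the pairs [(u, w)] so obtained preserve dot
products ([asymptotic_image_exists], [asymptotic_image_dot]).  As [mu A] is
positive, no nonzero vector of [E] is orthogonal to all cluster directions,
and the correspondence of [u] with [w] extends to a linear isometry [U] of [E]
into [F] ([extend_isometry]).

Comparing the horofunctions (Busemann functions) of [E] and [F] at such a pair
gives [|(f x - f z, w) - (x - z, u)| <= 2 eps] for [x, z] in [A]
([asymptotic_image_defect]); one [eps] comes from each of [x] and [z], and the
distances from the base point cancel.  With [P] the projection onto the range
of [U], this says that the displacement [P (f x) - U x], seen in [E] through
[U], varies by at most [2 eps] in every cluster direction, hence by at most
[2 c' eps] in norm, by the definition of [mu] ([mu_bound]).  The displacements
therefore lie in a ball of [F] of radius [J(F) c' eps] ([jung_ball]), and [T]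
is [U] translated by the projection of the centre of that ball.

Existence of projections, attainment of the Jung radius and [J(F) <= sqrt 2] all
rest on one fact: the infimum of the radii of balls that contain a given set and
are centred in a given closed convex set is attained ([chebyshev_centre]). *)

(** * Real inner products *)

Section InnerProduct.
Variables (R : realType) (V : normedModType R) (dot : {dot V for @idfun R}).
Hypothesis dotV : induces_norm dot.

Lemma dotC x y : dot x y = dot y x.
Proof. by rewrite hermC expr0 mul1r. Qed.

Lemma dotDl x y z : dot (x + y) z = dot x z + dot y z.
Proof. exact: linearDl. Qed.

Lemma dotBl x y z : dot (x - y) z = dot x z - dot y z.
Proof. exact: linearBl. Qed.

Lemma dotZl a x y : dot (a *: x) y = a * dot x y.
Proof. exact: linearZl_LR. Qed.

Lemma dotZr a x y : dot x (a *: y) = a * dot x y.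
Proof. by rewrite dotC dotZl dotC. Qed.

Lemma norm_sqrD x y : `|x + y| ^+ 2 = `|x| ^+ 2 + 2 * dot x y + `|y| ^+ 2.
Proof.
by rewrite -!dotV dotDl dotC (dotC y) !dotDl (dotC y x); ring.
Qed.

Lemma norm_sqrB x y : `|x - y| ^+ 2 = `|x| ^+ 2 - 2 * dot x y + `|y| ^+ 2.
Proof.
by rewrite norm_sqrD normrN -scaleN1r dotZr; ring.
Qed.

(** By polarization the form is a continuous function of norms. *)
Lemma cvg_dot (u v : nat -> V) (x y : V) :
  u @ \oo --> x -> v @ \oo --> y -> (fun n => dot (u n) (v n)) @ \oo --> dot x y.
Proof.
move=> ux vy.
have polar a b : dot a b = 4^-1 * (`|a + b| ^+ 2 - `|a - b| ^+ 2).
  by rewrite norm_sqrD norm_sqrB; field.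
rewrite polar; under eq_fun do rewrite polar.
apply: cvgM; first exact: cvg_cst.
apply: cvgB; rewrite expr2; under eq_fun do rewrite expr2.
  by apply: cvgM; apply: cvg_norm; apply: cvgD.
by apply: cvgM; apply: cvg_norm; apply: cvgB.
Qed.

(** Stewart's theorem for the point at the fraction [t] of the way from [x] to [y]:
the last term is the strict convexity gained at interior points. *)
Lemma stewart (t : R) (x y z : V) :
  `|z - (x + t *: (y - x))| ^+ 2 =
  (1 - t) * `|z - x| ^+ 2 + t * `|z - y| ^+ 2 - t * (1 - t) * `|x - y| ^+ 2.
Proof.
have -> : z - (x + t *: (y - x)) = (z - x) - t *: (y - x).
  by rewrite opprD addrA.
have -> : z - y = (z - x) - (y - x) by rewrite opprB addrA subrK.
rewrite (distrC x y); move: (z - x) (y - x) => a b.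
by rewrite !norm_sqrB dotZr normrZ exprMn real_normK ?num_real//; ring.
Qed.

End InnerProduct.

(** * Sequences in normed spaces *)

Lemma cauchy_seq_cvg (R : realType) (V : completeNormedModType R) (u : nat -> V) :
  (forall e : R, 0 < e -> exists N, forall m n, (N <= m)%N -> (N <= n)%N ->
     `|u m - u n| <= e) -> exists l : V, u @ \oo --> l.
Proof.
move=> uC; apply/cvg_ex/cauchy_cvgP/cauchy_ballP => e e0; near_simpl.
have [|N uN] := uC (e / 2); first by rewrite divr_gt0.
exists ([set n | (N <= n)%N], [set n | (N <= n)%N]).
  by split; exists N.
move=> [m n] /= [Nm Nn]; rewrite -ball_normE /=.
by apply: le_lt_trans (uN _ _ Nm Nn) _; rewrite ltr_pdivrMr// ltr_pMr// ltr1n.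
Qed.

Lemma closure_seq (R : realType) (V : normedModType R) (S : set V) (x : V) :
  closure S x -> exists u : nat -> V,
    (forall n, S (u n)) /\ forall n, `|x - u n| < n.+1%:R^-1.
Proof.
move=> Sx.
suff /choice[u uP] : forall n : nat, exists y, S y /\ `|x - y| < n.+1%:R^-1.
  by exists u; split=> n; case: (uP n).
move=> n; have [|y [Sy yb]] := Sx (ball x n.+1%:R^-1).
  by apply: nbhsx_ballx; rewrite invr_gt0.
by exists y; split=> //; move: yb; rewrite -ball_normE.
Qed.

Lemma cvg_harmonic_dist (R : realType) (V : normedModType R) (u : nat -> V) x :
  (forall n, `|x - u n| < n.+1%:R^-1) -> u @ \oo --> x.
Proof.
move=> ux; apply/cvgrPdist_le => e e0.
have := @cvg_harmonic R; move/cvgrPdist_le => /(_ e e0).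
apply: filterS => n; rewrite sub0r normrN /= ger0_norm ?invr_ge0// => he.
exact: le_trans (ltW (ux n)) he.
Qed.

(** * Relative Chebyshev centres *)

Section ChebyshevCentre.
Variables (R : realType) (V : completeNormedModType R).
Variables (dot : {dot V for @idfun R}).
Hypothesis dotV : induces_norm dot.

(** Radii of the closed balls centred in [M] that contain [Q].  For [Q] a single
point, minimising over them is the metric projection onto [M]; for [M] the whole
space, it gives the circumradius of [Q]. *)
Definition radii (M Q : set V) : set R :=
  [set r | exists2 c, M c & forall q, Q q -> `|q - c| <= r].

Definition midpoint_closed (M : set V) :=
  forall x y, M x -> M y -> M (x + 2^-1 *: (y - x)).

Lemma radii_ge0 M Q q : Q q -> lbound (radii M Q) 0.
Proof. by move=> Qq r [c _ /(_ _ Qq)]; apply: le_trans. Qed.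

Lemma inf_radii_ge0 M Q q : Q q -> radii M Q !=set0 -> 0 <= inf (radii M Q).
Proof. by move=> Qq r0; apply: lb_le_inf r0 (radii_ge0 Qq). Qed.

Lemma inf_radii_le M Q q r : Q q -> radii M Q r -> inf (radii M Q) <= r.
Proof. by move=> Qq; apply: ge_inf; exists 0; apply: radii_ge0 Qq. Qed.

(** Centres whose radii are close to the infimum are close to each other:
otherwise, by Stewart's theorem, their midpoint would be the centre of a smaller
ball containing [Q].  Almost optimal centres thus form a Cauchy sequence. *)
Lemma chebyshev_centre M Q q : closed M -> midpoint_closed M -> Q q ->
  radii M Q !=set0 -> radii M Q (inf (radii M Q)).
Proof.
move=> clM midM Qq r0; set r := inf _.
have r_ge0 : 0 <= r by exact: inf_radii_ge0 Qq r0.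
have /choice[c cP] n : exists c, M c /\
    forall q, Q q -> `|q - c| <= r + n.+1%:R^-1.
  have n0 : 0 < n.+1%:R^-1 :> R by rewrite invr_gt0.
  have infS : has_inf (radii M Q) by split=> //; exists 0; apply: radii_ge0 Qq.
  have [s [c Mc cs] sr] := inf_adherent n0 infS.
  by exists c; split=> // p /cs /le_trans; apply; exact: ltW.
have cC N m n : (N <= m)%N -> (N <= n)%N ->
    `|c m - c n| ^+ 2 <= 4 * (2 * r + 1) * N.+1%:R^-1.
  move=> Nm Nn; set d := N.+1%:R^-1.
  have d0 : 0 < d by rewrite invr_gt0.
  have d1 : d <= 1 by rewrite invf_le1// ler1n.
  have near_c k : (N <= k)%N -> forall p, Q p -> `|p - c k| ^+ 2 <= (r + d) ^+ 2.
    move=> Nk p Qp; rewrite ler_sqr ?nnegrE ?addr_ge0 ?(ltW d0)//.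
    apply: le_trans ((cP k).2 _ Qp) _; rewrite lerD2l lef_pV2 ?posrE//.
    by rewrite ler_nat ltnS.
  (* [D] bounds the squared radius of [Q] around the midpoint of the two centres. *)
  pose D := (r + d) ^+ 2 - 4^-1 * `|c m - c n| ^+ 2.
  have mid p : Q p -> `|p - (c m + 2^-1 *: (c n - c m))| ^+ 2 <= D.
    move=> Qp; rewrite (stewart dotV) /D.
    have := near_c _ Nm _ Qp; have := near_c _ Nn _ Qp; lra.
  have D0 : 0 <= D by apply: le_trans (mid _ Qq); rewrite sqr_ge0.
  have rD : r <= Num.sqrt D.
    apply: inf_radii_le Qq _; exists (c m + 2^-1 *: (c n - c m)).
      by apply: midM; [exact: (cP m).1 | exact: (cP n).1].
    move=> p /mid pD; rewrite -(ger0_norm (normr_ge0 (p - _))) -sqrtr_sqr.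
    exact: ler_wsqrtr.
  have : r ^+ 2 <= D.
    by rewrite -(sqr_sqrtr D0) ler_sqr ?nnegrE ?sqrtr_ge0.
  rewrite /D; nra.
have [e e0|l cl] := @cauchy_seq_cvg _ _ c.
  pose K := 4 * (2 * r + 1); have K0 : 0 <= K / e ^+ 2.
    by rewrite divr_ge0 ?sqr_ge0// /K; lra.
  exists (Num.bound (K / e ^+ 2)) => m n Nm Nn.
  rewrite -ler_sqr ?nnegrE ?(ltW e0)//; apply: le_trans (cC _ _ _ Nm Nn) _.
  rewrite -/K ler_pdivrMr// mulrC -ler_pdivrMr ?exprn_gt0//.
  by apply/ltW/(lt_le_trans (archi_boundP K0)); rewrite ler_nat.
exists l; first by apply: (closed_cvg _ clM _ l cl); apply: nearW => n; exact: (cP n).1.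
move=> p Qp.
have rn : (fun n => r + n.+1%:R^-1) @ \oo --> r.
  rewrite -[X in _ --> X]addr0; apply: cvgD; first exact: cvg_cst.
  exact: cvg_harmonic.
have pl : (fun n => `|p - c n|) @ \oo --> `|p - l|.
  by apply: cvg_norm; apply: cvgB => //; exact: cvg_cst.
by apply: (ler_cvg_to pl rn); apply: nearW => n; exact: (cP n).2.
Qed.
End ChebyshevCentre.

(** * Projections and the Jung constant *)

Lemma closed_subspace0 (R : realType) (V : normedModType R) (M : set V) :
  closed_subspace M -> M 0.
Proof. by case=> -[+ _] _; rewrite inE. Qed.

Lemma closed_subspace_comb (R : realType) (V : normedModType R)
    (M : set V) (a : R) x y :
  closed_subspace M -> M x -> M y -> M (a *: x + y).
Proof. by case=> -[_ /(_ a x y)] + _ Mx My; rewrite !inE; apply. Qed.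

Section ProjectionJung.
Variables (R : realType) (V : completeNormedModType R).
Variables (dot : {dot V for @idfun R}).
Hypothesis dotV : induces_norm dot.

Lemma orthogonal_projection_exists (M : set V) :
  closed_subspace M -> exists P, orthogonal_projection dot M P.
Proof.
move=> Msub; have [_ clM] := Msub.
suff /choice[P PP] : forall y, exists p, M p /\ forall z, M z -> dot (y - p) z = 0.
  by exists P.
move=> y.
have M0 := closed_subspace0 Msub.
have midM : midpoint_closed M.
  move=> u v Mu Mv; rewrite addrC; apply: closed_subspace_comb => //.
  by rewrite addrC -scaleN1r; exact: closed_subspace_comb.
have radM : radii M [set y] !=set0.
  by exists `|y|; exists 0 => // q ->; rewrite subr0.
have [p Mp yp] := chebyshev_centre dotV clM midM (erefl : [set y] y) radM.
exists p; split=> // z Mz.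
(* No point of the line from [p] in the direction [z] is closer to [y]. *)
have minp t : `|y - p| ^+ 2 <= `|(y - p) - t *: z| ^+ 2.
  rewrite ler_sqr ?nnegrE//; apply: le_trans (yp _ erefl) _.
  apply: (@inf_radii_le _ _ _ _ y) => //; exists (t *: z + p).
    exact: closed_subspace_comb.
  by move=> q ->; rewrite opprD addrA addrAC.
have [->|z0] := eqVneq z 0; first by rewrite dotC linear0l.
have zz : 0 < `|z| ^+ 2 by rewrite exprn_gt0// normr_gt0.
(* The value of [t] that minimises the right-hand side. *)
have := minp (dot (y - p) z / `|z| ^+ 2); move: (y - p) => w.
rewrite (norm_sqrB dotV) dotZr normrZ exprMn real_normK ?num_real// => min_w.
have : dot w z ^+ 2 / `|z| ^+ 2 <= 0.
  suff -> : dot w z ^+ 2 / `|z| ^+ 2 =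
     2 * (dot w z / `|z| ^+ 2 * dot w z) - (dot w z / `|z| ^+ 2) ^+ 2 * `|z| ^+ 2.
    by lra.
  by field; rewrite normr_eq0.
rewrite pmulr_lle0 ?invr_gt0// => wz0; apply/eqP; rewrite -sqrf_eq0.
by rewrite eq_le wz0 sqr_ge0.
Qed.

(** Replacing a centre by its projection onto a subspace keeps points of the
subspace within the same radius. *)
Lemma orthogonal_projection_closer (M : set V) P z b :
  closed_subspace M -> orthogonal_projection dot M P -> M z ->
  `|z - P b| <= `|z - b|.
Proof.
move=> Msub PP Mz; have [MPb b_orth] := PP b.
have Mz' : M (z - P b) by rewrite addrC -scaleN1r; exact: closed_subspace_comb.
have -> : z - b = (z - P b) - (b - P b) by rewrite opprB addrA subrK.
rewrite -ler_sqr ?nnegrE// [leRHS](norm_sqrB dotV) dotC b_orth//.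
by rewrite mulr0 subr0 lerDl sqr_ge0.
Qed.

(** Let [c] be the Chebyshev centre and [r] the circumradius.  Moving [c] by the
fraction [t] towards a point [q] of [Q] cannot reduce the radius; as all other
points are within 2 of [q], Stewart's theorem turns this into
[r^2 <= 4 - (1 - t) |q - c|^2].  Letting [t] tend to 0 and adding
[|q - c|^2 <= r^2] gives [2 |q - c|^2 <= 4]. *)
Lemma circumradius_le_sqrt2 (Q : set V) q0 : Q q0 ->
  (forall x y, Q x -> Q y -> `|x - y| <= 2) ->
  exists c, forall q, Q q -> `|q - c| <= Num.sqrt 2.
Proof.
move=> Qq0 diamQ.
have radQ : radii setT Q !=set0 by exists 2; exists q0 => // q Qq; apply: diamQ.
have [//|c _ Qc] := chebyshev_centre dotV closedT _ Qq0 radQ.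
have r_ge0 := inf_radii_ge0 Qq0 radQ.
set r := inf _ in Qc r_ge0.
exists c => q Qq.
have sq_le p s : 0 <= s -> (`|p| <= Num.sqrt s) = (`|p : V| ^+ 2 <= s).
  by move=> s0; rewrite -[in RHS](sqr_sqrtr s0) ler_sqr ?nnegrE ?sqrtr_ge0.
rewrite sq_le//.
have key t : 0 < t -> t < 1 -> r ^+ 2 <= 4 - (1 - t) * `|q - c| ^+ 2.
  move=> t0 t1.
  pose D := (1 - t) * r ^+ 2 + t * 4 - t * (1 - t) * `|q - c| ^+ 2.
  have QD p : Q p -> `|p - (c + t *: (q - c))| ^+ 2 <= D.
    move=> Qp; rewrite (stewart dotV) /D (distrC c).
    have pc : `|p - c| ^+ 2 <= r ^+ 2 by rewrite ler_sqr ?nnegrE ?Qc.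
    have pq : `|p - q| ^+ 2 <= 2 ^+ 2 by rewrite ler_sqr ?nnegrE ?diamQ.
    by rewrite lerD2r lerD// ler_pM2l//; [lra | move: pq; lra].
  have D0 : 0 <= D by apply: le_trans (QD _ Qq); rewrite sqr_ge0.
  have : r <= Num.sqrt D.
    apply: (inf_radii_le Qq0); exists (c + t *: (q - c)) => // p /QD.
    by rewrite sq_le.
  rewrite -ler_sqr ?nnegrE ?sqrtr_ge0// sqr_sqrtr// /D => rD.
  rewrite -(ler_pM2l t0); move: rD; lra.
have qr : `|q - c| ^+ 2 <= r ^+ 2 by rewrite ler_sqr ?nnegrE ?Qc.
set d := `|q - c| ^+ 2 in key qr *.
have d0 : 0 <= d by exact: sqr_ge0.
rewrite leNgt; apply/negP => d2.
(* If [d > 2], adding [d <= r^2] to [key t] gives [d * (2 - t) <= 4], which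
   fails for every [t < 2 * (d - 2) / d]. *)
have t0 : 0 < (d - 2) / d by rewrite divr_gt0; lra.
have t1 : (d - 2) / d < 1 by rewrite ltr_pdivrMr; lra.
have := key _ t0 t1; rewrite mulrBl mul1r mulfVK; first lra.
by apply/negP => /eqP; lra.
Qed.

Lemma diam_leP (Q : set V) (s : R) :
  (diam Q <= s%:E)%E <-> forall x y, Q x -> Q y -> `|x - y| <= s.
Proof.
split=> [Qs x y Qx Qy|Qs].
  rewrite -lee_fin; apply: le_trans Qs.
  by apply: ereal_sup_ubound; exists x, y.
by apply: ge_ereal_sup => _ [x [y [Qx Qy ->]]]; rewrite lee_fin Qs.
Qed.

Let jung_radii := [set r : R | 0 < r /\ forall Q : set V, (diam Q <= 2%:E)%E ->
  exists c : V, Q `<=` closed_ball c r].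

Let jung_radii_sqrt2 : jung_radii (Num.sqrt 2).
Proof.
split=> [|Q /diam_leP Q2]; first by rewrite sqrtr_gt0.
have [->|/set0P[q0 Qq0]] := eqVneq Q set0; first by exists 0.
have [c Qc] := circumradius_le_sqrt2 Qq0 Q2; exists c.
rewrite closed_ballE ?sqrtr_gt0// => q /Qc.
by rewrite /closed_ball_ /= distrC.
Qed.

Lemma jung_le_sqrt2 : jung V <= Num.sqrt 2.
Proof. by apply: ge_inf jung_radii_sqrt2; exists 0 => r [/ltW]. Qed.

(** The ball of radius exactly [jung V * s] exists because the infimum of the
circumscribed radii is attained. *)
Lemma jung_ball (Q : set V) q0 (s : R) : 0 <= s -> Q q0 ->
  (forall x y, Q x -> Q y -> `|x - y| <= 2 * s) ->
  exists c, forall q, Q q -> `|q - c| <= jung V * s.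
Proof.
rewrite le_eqVlt => /predU1P[<-|s0] Qq0 Qs.
  by exists q0 => q Qq; apply: le_trans (Qs _ _ Qq Qq0) _; rewrite !mulr0.
have rescale r : jung_radii r -> radii setT Q (r * s).
  move=> [r0 /(_ [set s^-1 *: q | q in Q])] [|c].
    apply/diam_leP => _ _ [x Qx <-] [y Qy <-].
    rewrite -scalerBr normrZ gtr0_norm ?invr_gt0// mulrC ler_pdivrMr//.
    exact: Qs.
  rewrite closed_ballE// => Qc; exists (s *: c) => // q Qq.
  have /Qc : [set s^-1 *: q | q in Q] (s^-1 *: q) by exists q.
  rewrite /closed_ball_ /= distrC => qc.
  rewrite -[q](scalerKV (lt0r_neq0 s0)) -scalerBr normrZ gtr0_norm//.
  by rewrite mulrC ler_pM2r.
have radQ : radii setT Q !=set0.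
  by exists (Num.sqrt 2 * s); exact: rescale jung_radii_sqrt2.
have [//|c _ Qc] := chebyshev_centre dotV closedT _ Qq0 radQ.
exists c => q Qq; apply: le_trans (Qc _ Qq) _; rewrite -ler_pdivrMr//.
apply: lb_le_inf; first by exists (Num.sqrt 2).
by move=> r /rescale rQ; rewrite ler_pdivrMr//; exact: (inf_radii_le Qq0).
Qed.

End ProjectionJung.

(** * Extending a dot-preserving correspondence *)

Lemma seq_closed (R : realType) (V : normedModType R) (S : set V) :
  (forall (u : nat -> V) x, (forall n, S (u n)) -> u @ \oo --> x -> S x) ->
  closed S.
Proof.
by move=> Sseq x /closure_seq[u [Su ux]]; apply: Sseq Su (cvg_harmonic_dist ux).
Qed.

Lemma closed_subspace_intro (R : realType) (V : normedModType R) (M : set V) :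
  M 0 -> (forall (a : R) x y, M x -> M y -> M (a *: x + y)) ->
  (forall (u : nat -> V) x, (forall n, M (u n)) -> u @ \oo --> x -> M x) ->
  closed_subspace M.
Proof.
move=> M0 MP Mseq; split; last exact: seq_closed.
by split=> [|a x y]; rewrite !inE//; exact: MP.
Qed.

Lemma closed_subspace_span (R : realType) (V : normedModType R) (S : set V) :
  closed_subspace (smallest (@closed_subspace R V) S).
Proof.
apply: closed_subspace_intro => [M [Msub _]|a x y Sx Sy M MS|u x Su ux M MS].
- exact: closed_subspace0.
- exact: (closed_subspace_comb a MS.1 (Sx _ MS) (Sy _ MS)).
- by apply: (closed_cvg _ MS.1.2 _ x ux); apply: nearW => n; exact: Su.
Qed.

(** A sequence with the same mutual distances as a convergent one is Cauchy. *)
Lemma cvg_isometric (R : realType) (X : normedModType R)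
    (Y : completeNormedModType R) (u : nat -> X) (v : nat -> Y) (x : X) :
  (forall m n, `|v m - v n| = `|u m - u n|) -> u @ \oo --> x ->
  exists y : Y, v @ \oo --> y.
Proof.
move=> uv ux; apply: cauchy_seq_cvg => e e0.
have /cvgrPdist_le/(_ (e / 2)) := ux; case=> [|N _ uN]; first by rewrite divr_gt0.
exists N => m n Nm Nn; rewrite uv (splitr e).
rewrite -[u m](subrK x) -addrA (le_trans (ler_normD _ _))// lerD ?uN//.
by rewrite distrC uN.
Qed.

Lemma cvg_fst_seq (R : realType) (X Y : normedModType R) (u : nat -> X * Y) (p : X * Y) :
  u @ \oo --> p -> (fun n => (u n).1) @ \oo --> p.1.
Proof. by move=> up; apply: (cvg_comp _ _ up); exact: cvg_fst. Qed.

Lemma cvg_snd_seq (R : realType) (X Y : normedModType R) (u : nat -> X * Y) (p : X * Y) :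
  u @ \oo --> p -> (fun n => (u n).2) @ \oo --> p.2.
Proof. by move=> up; apply: (cvg_comp _ _ up); exact: cvg_snd. Qed.

Section ExtendIsometry.
Variables (R : realType) (E F : completeNormedModType R).
Variables (dotE : {dot E for @idfun R}) (dotF : {dot F for @idfun R}).
Hypotheses (hE : induces_norm dotE) (hF : induces_norm dotF).

Lemma closed_subspace_dot_eq (a : E) (b : F) :
  closed_subspace [set p : E * F | dotE p.1 a = dotF p.2 b].
Proof.
apply: closed_subspace_intro => /= [|t p q pab qab|u p uab up].
- by rewrite !linear0l.
- by rewrite !dotDl !dotZl pab qab.
- have uE : (fun n => dotE (u n).1 a) @ \oo --> dotE p.1 a.
    by apply: (cvg_dot hE (cvg_fst_seq up)); exact: cvg_cst.
  have uF : (fun n => dotF (u n).2 b) @ \oo --> dotF p.2 b.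
    by apply: (cvg_dot hF (cvg_snd_seq up)); exact: cvg_cst.
  rewrite (_ : (fun n => dotE _ _) = fun n => dotF (u n).2 b) in uE.
    exact: norm_cvg_unique uE uF.
  by apply/funext => n; exact: uab.
Qed.

Lemma isometry_dist (U : E -> F) :
  (forall a x y, U (a *: x + y) = a *: U x + U y) ->
  (forall x y, dotF (U x) (U y) = dotE x y) ->
  forall x y, `|U x - U y| = `|x - y|.
Proof.
move=> Ulin Udot x y; have -> : U x - U y = U (x - y).
  by rewrite addrC -scaleN1r -Ulin scaleN1r addrC.
by apply/eqP; rewrite -(@eqrXn2 _ 2)// -hE -hF Udot.
Qed.

Lemma isometry_range (U : E -> F) :
  (forall a x y, U (a *: x + y) = a *: U x + U y) ->
  (forall x y, `|U x - U y| = `|x - y|) -> closed_subspace (range U).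
Proof.
move=> Ulin Udist.
apply: closed_subspace_intro => [|a _ _ [x _ <-] [y _ <-]|v y + vy].
- exists 0 => //; have := Ulin 1 0 0.
  by rewrite !scale1r addr0 -{1}[U 0]addr0 => /addrI.
- by exists (a *: x + y).
- move=> vU.
  have /choice[u uP] n : exists x, U x = v n by have [x _ xv] := vU n; exists x.
  have [m n|x ux] := @cvg_isometric _ _ _ v u y _ vy.
    by rewrite -!uP Udist.
  exists x => //; apply/esym/(norm_cvg_unique vy).
  have -> : v = U \o u by apply/funext => n; rewrite /= uP.
  apply/cvgrPdist_le => e e0; have /cvgrPdist_le/(_ e e0) := ux.
  by apply: filterS => n; rewrite /= Udist.
Qed.
Variable G0 : set (E * F).
Hypothesis G0_dot : forall p q, G0 p -> G0 q -> dotE p.1 q.1 = dotF p.2 q.2.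
Hypothesis G0_total :
  forall d, (forall p, G0 p -> dotE d p.1 = 0) -> d = 0.

Let G := smallest (@closed_subspace R (E * F)%type) G0.

Let G_sub : closed_subspace G.
Proof. exact: closed_subspace_span. Qed.

(* Agreement of dot products with a fixed pair is a closed linear condition, so
   it passes from [G0] to its closed span in one argument at a time. *)
Let G_dot p q : G p -> G q -> dotE p.1 q.1 = dotF p.2 q.2.
Proof.
move=> + Gq; apply: (smallest_sub (closed_subspace_dot_eq q.1 q.2)) => r G0r /=.
rewrite dotC (dotC dotF).
move: q Gq; apply: (smallest_sub (closed_subspace_dot_eq r.1 r.2)) => q G0q /=.
exact: G0_dot.
Qed.

Let G_norm p : G p -> `|p.1| = `|p.2|.
Proof.
by move=> Gp; apply/eqP; rewrite -(@eqrXn2 _ 2)// -hE -hF (G_dot Gp Gp).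
Qed.

Let G_dist p q : G p -> G q -> `|p.1 - q.1| = `|p.2 - q.2|.
Proof.
move=> Gp Gq; suff /G_norm : G (p - q) by [].
by rewrite addrC -scaleN1r; exact: (closed_subspace_comb (-1) G_sub Gq Gp).
Qed.

Let D := [set x | exists y, G (x, y)].

Let D_sub : closed_subspace D.
Proof.
apply: closed_subspace_intro => [|a x y [x' Gx] [y' Gy]|u x /choice[v Guv] ux].
- by exists 0; exact: (closed_subspace0 G_sub).
- by exists (a *: x' + y'); exact: (closed_subspace_comb a G_sub Gx Gy).
- have [m n|y vy] := @cvg_isometric _ _ _ u v x _ ux.
    by have := G_dist (Guv m) (Guv n).
  exists y; apply: (closed_cvg _ G_sub.2 _ (x, y) (cvg_pair ux vy)).
  exact: nearW.
Qed.

(** The closed span [G] of [G0] is the graph of the isometry: dot products agree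
on [G], hence it is single-valued and its domain [D] is closed; as [D] contains
the first components of [G0], its orthogonal complement vanishes. *)
Lemma extend_isometry : exists U : E -> F,
  [/\ forall a x y, U (a *: x + y) = a *: U x + U y,
      forall x y, dotF (U x) (U y) = dotE x y &
      forall p, G0 p -> U p.1 = p.2].
Proof.
have [P PP] := orthogonal_projection_exists hE D_sub.
have DT x : D x.
  suff -> : x = P x by exact: (PP x).1.
  apply/eqP; rewrite -subr_eq0; apply/eqP/G0_total => p G0p.
  by apply: (PP x).2; exists p.2; rewrite -surjective_pairing; exact: sub_gen_smallest.
have [U GU] := choice DT.
have G_fun x y z : G (x, y) -> G (x, z) -> y = z.
  move=> Gy Gz; apply/eqP; rewrite -subr_eq0 -normr_eq0.
  by rewrite -(G_dist Gy Gz) subrr normr0.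
exists U; split=> [a x y|x y|p G0p].
- by apply: G_fun (GU _) _; exact: (closed_subspace_comb a G_sub (GU x) (GU y)).
- by rewrite -(G_dot (GU x) (GU y)).
- by apply: G_fun (GU _) _; rewrite -surjective_pairing; exact: sub_gen_smallest.
Qed.

End ExtendIsometry.

(** * Images of cluster directions *)

Lemma sqr_defect (R : realType) (a p K : R) : 0 <= a -> 0 <= p ->
  `|a - p| <= K -> `|a ^+ 2 - p ^+ 2| <= K * (2 * p + K).
Proof.
move=> a0 p0 apK; rewrite subr_sqr normrM; apply: ler_pM => //.
rewrite ger0_norm ?addr_ge0//; move: apK; rewrite ler_norml => /andP[]; lra.
Qed.

Lemma cvg_invr_pinfty (R : realType) (t : nat -> R) :
  t @ \oo --> +oo -> (fun j => (t j)^-1) @ \oo --> 0.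
Proof.
move=> t_oo; apply/gtr0_cvgV0 => //.
by move/cvgryPgt : t_oo; exact.
Qed.

(** The horofunction of the direction [w] in a Hilbert space is [- dot _ w].  The
difference of distances is the quotient of a difference of squares by a sum of
distances; after division by [t j] the latter tends to 2. *)
Lemma busemann (R : realType) (V : normedModType R) (dot : {dot V for @idfun R})
    (dotV : induces_norm dot) (y : nat -> V) (t : nat -> R) (w a b : V) :
  t @ \oo --> +oo -> (fun j => (t j)^-1 *: y j) @ \oo --> w -> `|w| = 1 ->
  (fun j => `|a - y j| - `|b - y j|) @ \oo --> - dot (a - b) w.
Proof.
move=> t_oo yw w1; have tV0 := cvg_invr_pinfty t_oo.
have scaled_dist c : (fun j => `|(t j)^-1 *: c - (t j)^-1 *: y j|) @ \oo --> (1 : R).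
  rewrite -w1 -(normrN w) -(sub0r w) -(scale0r c); apply: cvg_norm.
  by apply: cvgB => //; apply: cvgZ => //; exact: cvg_cst.
pose D j := `|(t j)^-1 *: a - (t j)^-1 *: y j| + `|(t j)^-1 *: b - (t j)^-1 *: y j|.
pose N j := (t j)^-1 * (`|a| ^+ 2 - `|b| ^+ 2) - 2 * dot (a - b) ((t j)^-1 *: y j).
have DE : D @ \oo --> (2 : R) by rewrite -[X in _ --> X]/(1 + 1); exact: cvgD.
have NE : N @ \oo --> - (2 * dot (a - b) w).
  rewrite -sub0r -[X in X - _](mul0r (`|a| ^+ 2 - `|b| ^+ 2)).
  apply: cvgB; first by apply: cvgM => //; exact: cvg_cst.
  apply: cvgM; first exact: cvg_cst.
  by apply: (cvg_dot dotV) => //; exact: cvg_cst.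
have -> : - dot (a - b) w = - (2 * dot (a - b) w) / 2 by field.
have NDE : (fun j => N j / D j) @ \oo --> - (2 * dot (a - b) w) / 2.
  by apply: cvgM => //; apply: cvgV.
apply: cvg_trans NDE; apply: near_eq_cvg.
have D0 : \forall j \near \oo, D j != 0 by apply: cvgr_neq0 DE _.
have t0 : \forall j \near \oo, 0 < t j by move/cvgryPgt : t_oo; exact.
near=> j.
have Dj : D j != 0 by near: j.
have tj : 0 < t j by near: j.
have DjE : D j = (t j)^-1 * (`|a - y j| + `|b - y j|).
  by rewrite /D -!scalerBr !normrZ gtr0_norm ?invr_gt0// mulrDr.
apply: (mulIf Dj); rewrite mulfVK// DjE mulrCA -subr_sqr.
by rewrite !(norm_sqrB dotV) /N dotZr dotBl; ring.
Unshelve. all: by end_near. Qed.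

Lemma sum3_bounds (R : realType) (r s t : R) : 0 <= r -> 0 <= s -> 0 <= t ->
  [/\ r <= r + s + t, s <= r + s + t, t <= r + s + t & 0 <= r + s + t].
Proof. by move=> r0 s0 t0; split; lra. Qed.

Lemma sub_defect (R : realType) (a b a' b' e : R) :
  a - e <= b <= a + e -> a' - e <= b' <= a' + e ->
  `|(b - b') - (a - a')| <= 2 * e.
Proof. by move=> /andP[? ?] /andP[? ?]; rewrite ler_norml; lra. Qed.

Section AsymptoticImages.
Variables (R : realType) (E F : completeNormedModType R).
Variables (dotE : {dot E for @idfun R}) (dotF : {dot F for @idfun R}).
Hypotheses (hE : induces_norm dotE) (hF : induces_norm dotF).
Variables (A : set E) (eps : R) (f : E -> F).
Hypotheses (eps_ge0 : 0 <= eps) (hf : nearisometry eps A f).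

(** Dot products are combinations of squared distances, which [f] changes by an
amount at most linear in [|x| + |y|]; division by [|x| * |y|] makes this
small.  Norms are distances from a base point [a] of [A], up to the constant
[|a| + |f a|]. *)
Lemma scaled_dot_defect (e : R) : 0 < e ->
  exists M, forall x y, A x -> A y -> M <= `|x| -> M <= `|y| ->
    `|dotF (`|x|^-1 *: f x) (`|y|^-1 *: f y)
      - dotE (`|x|^-1 *: x) (`|y|^-1 *: y)| <= e.
Proof.
move=> e0.
have [A0|/set0P[a Aa]] := eqVneq A set0.
  by exists 0 => x y; rewrite A0.
pose K := eps + `|a| + `|f a|.
have [epsK aK faK K0] := sum3_bounds eps_ge0 (normr_ge0 a) (normr_ge0 (f a)).
rewrite -/K in epsK aK faK K0.
have norm_defect x : A x -> `| `|f x| - `|x| | <= K.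
  move=> Ax; have /andP[lo hi] := hf Ax Aa.
  have := ler_normB (f x) (f a); have := ler_distD (f a) (f x) 0.
  have := ler_distD a x 0; have := ler_normB x a.
  rewrite ler_norml !subr0 /K; lra.
(* Large enough for [K <= p] and [6 * K <= e * p], and likewise for [q]. *)
exists (K + 6 * K / e + 1) => x y Ax Ay.
set p := `|x|; set q := `|y| => Mp Mq.
have Ke0 : 0 <= 6 * K / e by rewrite divr_ge0 ?mulr_ge0// ltW.
have [p0 q0] : 0 < p /\ 0 < q by lra.
have sqx := sqr_defect (normr_ge0 (f x)) (normr_ge0 x) (norm_defect _ Ax).
have sqy := sqr_defect (normr_ge0 (f y)) (normr_ge0 y) (norm_defect _ Ay).
have sqxy : `| `|f x - f y| ^+ 2 - `|x - y| ^+ 2 | <= K * (2 * (p + q) + K).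
  have /(sqr_defect (normr_ge0 _) (normr_ge0 _)) : `| `|f x - f y| - `|x - y| | <= K.
    by have /andP[lo hi] := hf Ax Ay; rewrite ler_norml; lra.
  move=> /le_trans; apply; rewrite ler_wpM2l// lerD2r ler_pM2l//.
  exact: ler_normB.
have defect : `|dotF (f x) (f y) - dotE x y| <= 2 * K * (p + q) + 3 / 2 * K ^+ 2.
  move: sqx sqy sqxy; rewrite (norm_sqrB hF) (norm_sqrB hE) !ler_norml -/p -/q.
  move=> /andP[? ?] /andP[? ?] /andP[? ?]; lra.
rewrite !dotZl !dotZr -/p -/q !mulrA -invfM -mulrBr normrM.
rewrite gtr0_norm ?invr_gt0 ?mulr_gt0// mulrC ler_pdivrMr ?mulr_gt0//.
apply: le_trans defect _.
have ep6 : 6 * K <= e * p.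
  by rewrite [e * _]mulrC -ler_pdivrMr//; lra.
have eq6 : 6 * K <= e * q.
  by rewrite [e * _]mulrC -ler_pdivrMr//; lra.
have Kp : K <= p by lra.
have Kq : K <= q by lra.
have e1 : 6 * K * q <= e * p * q by rewrite ler_pM2r.
have e2 : 6 * K * p <= e * p * q by rewrite [e * p * q]mulrAC ler_pM2r.
have e3 : K * K <= K * p by rewrite ler_wpM2l.
have e4 : K * K <= K * q by rewrite ler_wpM2l.
have e5 : 0 <= K * K by rewrite mulr_ge0.
rewrite expr2; lra.
Qed.

Definition asymptotic_image : set (E * F) :=
  [set p | `|p.1| = 1 /\ exists x : nat -> E, [/\ forall j, A (x j),
     (fun j => `|x j|) @ \oo --> +oo,
     (fun j => `|x j|^-1 *: x j) @ \oo --> p.1 &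
     (fun j => `|x j|^-1 *: f (x j)) @ \oo --> p.2]].

Lemma asymptotic_image_exists u : cluster_directions A u ->
  exists w, asymptotic_image (u, w).
Proof.
move=> [u1 [x [Ax x_oo xu]]].
have [e e0|w xw] := @cauchy_seq_cvg _ _ (fun j => `|x j|^-1 *: f (x j)); last first.
  by exists w; split=> //; exists x.
have [|M defect] := @scaled_dot_defect (e ^+ 2 / 8).
  by rewrite divr_gt0 ?exprn_gt0.
have /cvgryPge/(_ M)[N1 _ x_ge] := x_oo.
have /cvgrPdist_le/(_ (e / 4)) := xu.
case=> [|N2 _ u_near]; first by rewrite divr_gt0.
exists (maxn N1 N2) => m n; rewrite !geq_max => /andP[m1 m2] /andP[n1 n2].
have d := defect _ _ (Ax _) (Ax _) (x_ge _ _) (x_ge _ _).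
have := d _ _ m1 m1; have := d _ _ m1 n1; have := d _ _ n1 n1.
have umn : `| `|x m|^-1 *: x m - `|x n|^-1 *: x n| <= e / 2.
  have := ler_distD u (`|x m|^-1 *: x m) (`|x n|^-1 *: x n).
  have := u_near _ m2; have := u_near _ n2; rewrite /= (distrC u (_ *: x m)); lra.
move: (`|x m|^-1 *: x m) (`|x n|^-1 *: x n) umn => um un umn.
move: (`|x m|^-1 *: f (x m)) (`|x n|^-1 *: f (x n)) => wm wn.
have : `|um - un| ^+ 2 <= (e / 2) ^+ 2.
  by rewrite ler_sqr ?nnegrE// divr_ge0 ?(ltW e0).
rewrite -(@ler_sqr _ `|wm - wn|) ?nnegrE ?(ltW e0)//.
rewrite (norm_sqrB hE) (norm_sqrB hF) -!hE -!hF !ler_norml.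
move=> ? /andP[? ?] /andP[? ?] /andP[? ?]; lra.
Qed.

Lemma asymptotic_image_dot p q : asymptotic_image p -> asymptotic_image q ->
  dotE p.1 q.1 = dotF p.2 q.2.
Proof.
move=> [_ [x [Ax x_oo xu xw]]] [_ [y [Ay y_oo yu yw]]].
apply/esym/eqP; rewrite -subr_eq0 -normr_le0; apply/ler_addgt0Pr => e e0.
rewrite add0r; have [M defect] := scaled_dot_defect e0.
have lim_defect : (fun j =>
    `|dotF (`|x j|^-1 *: f (x j)) (`|y j|^-1 *: f (y j))
      - dotE (`|x j|^-1 *: x j) (`|y j|^-1 *: y j)|) @ \oo -->
    `|dotF p.2 q.2 - dotE p.1 q.1|.
  by apply: cvg_norm; apply: cvgB; apply: cvg_dot.
apply: (ler_cvg_to lim_defect (@cvg_cst _ e _ \oo _)).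
have x_ge : \forall j \near \oo, M <= `|x j| by move/cvgryPge : x_oo.
have y_ge : \forall j \near \oo, M <= `|y j| by move/cvgryPge : y_oo.
by near=> j; apply: defect => //; near: j.
Unshelve. all: by end_near. Qed.

(** For [y] in [A], replacing [|x - y| - |z - y|] by [|f x - f y| - |f z - f y|]
costs at most [2 eps]; let [y] tend to infinity in the direction [p.1]. *)
Lemma asymptotic_image_defect p x z : asymptotic_image p -> A x -> A z ->
  `|dotF (f x - f z) p.2 - dotE (x - z) p.1| <= 2 * eps.
Proof.
move=> pP Ax Az.
have w1 : `|p.2| = 1.
  apply/eqP; rewrite -(@eqrXn2 _ 2)// -hF -(asymptotic_image_dot pP pP) hE.
  by rewrite (proj1 pP).
have [u1 [y [Ay y_oo yu yw]]] := pP.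
have limF := busemann hF (a := f x) (b := f z) y_oo yw w1.
have limE := busemann hE (a := x) (b := z) y_oo yu u1.
rewrite -normrN opprB -[X in X - _]opprK addrC.
apply: (ler_cvg_to (cvg_norm (cvgB limF limE)) (@cvg_cst _ (2 * eps) _ \oo _)).
apply: nearW => j.
exact: sub_defect (hf Ax (Ay j)) (hf Az (Ay j)).
Qed.
End AsymptoticImages.

(** * The linear isometry and its displacement *)

Lemma sup_norm_ge0 (R : realType) (T : Type) (g : T -> R) (X : set T) :
  0 <= sup [set `|g u| | u in X].
Proof.
have [S|/sup_out ->//] := pselect (has_sup [set `|g u| | u in X]).
have [_ [u Xu _]] := S.1.
apply: le_trans (normr_ge0 (g u)) _; apply: sup_upper_bound => //.
by exists u.
Qed.

(** The bound on [mu] says that the cluster directions detect the norm of a vector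
up to the factor [c]; for [k = 0] it says that they span a dense subspace. *)
Lemma mu_bound (R : realType) (E : normedModType R) (dot : {dot E for @idfun R})
    (A : set E) (c k : R) (d : E) :
  0 < c -> 1 / c <= mu dot A -> 0 <= k ->
  (forall u, cluster_directions A u -> `|dot d u| <= k) -> `|d| <= c * k.
Proof.
move=> c0 cA k0 dk.
have [->|d0] := eqVneq d 0; first by rewrite normr0 mulr_ge0// ltW.
have nd0 : 0 < `|d| by rewrite normr_gt0.
pose e := `|d|^-1 *: d.
have e1 : `|e| = 1 by rewrite normrZ gtr0_norm ?invr_gt0// mulVf// gt_eqF.
have sigma_k : sigma_dir dot e (cluster_directions A) <= k / `|d|.
  have [->|/set0P[u Xu]] := eqVneq (cluster_directions A) set0.
    by rewrite /sigma_dir image_set0 sup0 divr_ge0.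
  apply: ge_sup; first by exists `|dot u e|; exists u.
  move=> _ [v Xv <-]; rewrite dotZr normrM gtr0_norm ?invr_gt0// mulrC.
  by rewrite ler_pM2r ?invr_gt0// dotC dk.
have mu_sigma : mu dot A <= sigma_dir dot e (cluster_directions A).
  apply: ge_inf; last by exists e.
  by exists 0 => _ [v _ <-]; exact: sup_norm_ge0.
have := le_trans (le_trans cA mu_sigma) sigma_k.
by rewrite div1r ler_pdivlMr// -ler_pdivlMl ?invr_gt0// invrK.
Qed.

Theorem mainTheorem3 (R : realType) (E F : completeNormedModType R)
  (dotE : {dot E for @idfun R}) (dotF : {dot F for @idfun R})
  (hE : induces_norm dotE) (hF : induces_norm dotF)
  (dimE : exists x : E, x != 0) (dimF : exists y : F, y != 0)
  (c' : R) (hc' : 0 < c')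
  (A : set E) (hA : ~ bounded_set A) (hmu : 1 / c' <= mu dotE A)
  (eps : R) (heps : 0 <= eps)
  (f : E -> F) (hf : nearisometry eps A f) :
  exists T : E -> F,
    [/\ distance_preserving T,
        closed_subspace (range T) &
        exists P : F -> F,
          orthogonal_projection dotF (range T) P /\
          (ereal_sup [set `|T x - P (f x)|%:E | x in A]
             <= (jung F * c' * eps)%:E <= (Num.sqrt 2 * c' * eps)%:E)%E].
Proof.
have [a Aa] : A !=set0.
  apply/set0P/eqP => A0; apply: hA; rewrite A0; by exists 0; split => // M _ x [].
pose G := asymptotic_image A f.
have G_total d : (forall p, G p -> dotE d p.1 = 0) -> d = 0.
  move=> dG; apply/eqP; rewrite -normr_le0 -(mulr0 c').
  apply: (mu_bound hc' hmu (lexx 0)) => u /(asymptotic_image_exists hE hF heps hf).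
  by move=> [w /dG/= ->]; rewrite normr0.
have G_dot := asymptotic_image_dot hE hF heps hf.
have [U [Ulin Udot UG]] := extend_isometry hE hF G_dot G_total.
have Udist := isometry_dist hE hF Ulin Udot.
have MU := isometry_range Ulin Udist.
have [P PP] := orthogonal_projection_exists hF MU.
have dotP y u : dotF (P y) (U u) = dotF y (U u).
  have /(_ (U u)) := (PP y).2; rewrite dotBl => /(_ _)/eqP.
  by rewrite subr_eq0 => H; apply/esym/eqP/H; exists u.
have /choice[g gP] x : exists d, U d = P (f x).
  by have [d _ dP] := (PP (f x)).1; exists d.
have sub_lin x y : U (x - y) = U x - U y.
  by rewrite addrC -scaleN1r Ulin scaleN1r addrC.
(* [g x - x] is the displacement [P (f x) - U x] pulled back to [E] by [U]. *)
have spread x z : A x -> A z -> `|(g x - x) - (g z - z)| <= 2 * (c' * eps).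
  move=> Ax Az; rewrite mulrCA.
  have eps2 : 0 <= 2 * eps by rewrite mulr_ge0.
  apply: (mu_bound hc' hmu eps2) => u.
  move=> /(asymptotic_image_exists hE hF heps hf)[w uw].
  have Uu : U u = w by exact: (UG _ uw).
  have := asymptotic_image_defect hE hF heps hf uw Ax Az; rewrite /= -Uu.
  have gu y : dotE (g y) u = dotF (f y) (U u) by rewrite -Udot gP dotP.
  by rewrite !dotBl !gu !opprB; congr (`|_| <= _); ring.
have [||b Qb] := @jung_ball _ _ _ hF [set P (f x) - U x | x in A] (P (f a) - U a)
    (c' * eps) (mulr_ge0 (ltW hc') heps).
- by exists a.
- move=> _ _ [x Ax <-] [z Az <-].
  by rewrite -!gP -[U (g x) - _]sub_lin -[U (g z) - _]sub_lin Udist spread.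
have [b' _ Ub'] := (PP b).1.
have Trange : range (fun x => U x + P b) = range U.
  have Uadd x : U x + P b = U (x + b') by rewrite -Ub' -[x]scale1r Ulin !scale1r.
  apply/seteqP; split=> _ [x _ <-]; first by exists (x + b').
  by exists (x - b') => //; rewrite Uadd subrK.
exists (fun x => U x + P b); rewrite Trange; split=> //.
  by move=> x y; rewrite opprD addrACA subrr addr0 Udist.
exists P; split=> //; apply/andP; split.
  apply: ge_ereal_sup => _ [x Ax <-]; rewrite lee_fin -mulrA.
  have Qx : [set P (f x) - U x | x in A] (P (f x) - U x) by exists x.
  apply: le_trans (Qb _ Qx).
  have MQx : range U (P (f x) - U x) by rewrite -gP -sub_lin; exists (g x - x).
  apply: le_trans (orthogonal_projection_closer hF b MU PP MQx).
  by rewrite -normrN opprB opprD addrA.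
rewrite lee_fin !ler_wpM2r ?(ltW hc')//; exact: jung_le_sqrt2 hF.
Qed.
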